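(* For every named $\mathrm{GS4}$ derivation $P$ with conclusion $\vdash\Gamma$ there is a cut-free named $\mathrm{GS4}$ derivation $Q$ with conclusion $\vdash\Gamma$ such that $\langle\!\langle P\rangle\!\rangle=\langle\!\langle Q\rangle\!\rangle$.
   Context: Named formulas and sequents. Fix a countably infinite set $\mathcal N$ of names and a set $\mathcal A$ of atoms with a fixpoint-free involution $\alpha\mapsto\bar\alpha$. Named formulas: $A,B::=\alpha^x\mid A\lor B\mid A\land B$ ($\alpha\in\mathcal A$, $x\in\mathcal N$); formulas $\alpha^x$ are atomic. Negation: $\overline{\alpha^x}=\bar\alpha^x$, $\overline{A\lor B}=\bar A\land\bar B$, $\overline{A\land B}=\bar A\lor\bar B$ (names preserved). $\mathrm{names}(A)$ is the set of names in $A$, $\mathrm{names}(\Gamma)=\bigcup_{A\in\Gamma}\mathrm{names}(A)$. $A\equiv B$ means $A,B$ coincide after erasing names. A formula is sharing-free if each name occurs in it at most once; a set is sharing-free if its members are sharing-free with pairwise disjoint name sets. A sequent $\vdash\Gamma$ is a finite sharing-free set $\Gamma$; in comma notation the components have pairwise disjoint name sets and $\Gamma,A=\Gamma\cup\{A\}$. Derivations. Named $\mathrm{GS4}$ derivations are finite trees of rule applications labelled with sharing-free sequents: axiom $\mathrm{ax}_{\{A,\bar B\}}$ (no premisses, conclusion $\vdash\Gamma,A,\bar B$, $A\equiv B$); cut (premisses $\vdash\Gamma,A$, $\vdash\Gamma,\bar A$, conclusion $\vdash\Gamma$); superposition $\sqcup$ (premisses $\vdash\Gamma$, $\vdash\Gamma$,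 conclusion $\vdash\Gamma$); $\lor$ (premiss $\vdash\Gamma,A,B$, conclusion $\vdash\Gamma,A\lor B$); $\land$ (premisses $\vdash\Gamma,A$, $\vdash\Gamma,B$, conclusion $\vdash\Gamma,A\land B$). Cut-free: no cut rule occurs. Branches. $\mathrm{Br}(\alpha^x)=\{\{x\}\}$, $\mathrm{Br}(B\lor C)=\{X\cup Y\mid X\in\mathrm{Br}(B),Y\in\mathrm{Br}(C)\}$, $\mathrm{Br}(B\land C)=\mathrm{Br}(B)\cup\mathrm{Br}(C)$; for sharing-free $\Gamma$, $\mathrm{Br}(\Gamma)=\{X\subseteq\mathrm{names}(\Gamma)\mid\forall A\in\Gamma,\ X\cap\mathrm{names}(A)\in\mathrm{Br}(A)\}$. Branch-labeled graphs. A bl-graph is $G=\langle V_G,\triangleleft_G\rangle$ with $V_G\subseteq\mathcal N$ and $\triangleleft_G$ a relation between 2-element subsets $e$ of $V_G$ and subsets $X\subseteq V_G$ such that $e\triangleleft_G X$ implies $e\subseteq X$. Union $\sqcup$ is componentwise union; equality is equality of both components. For $I\subseteq\mathcal N$: $e\triangleleft^I_G X$ iff $e\triangleleft_G Y$ for some $Y$ with $X=Y\setminus I$. An alternating $X$-labeled path between bl-graphs $G,H$ through $I$ is a sequence $x_1,\dots,x_n$ ($n>1$) of pairwise distinct vertices of $G$ or $H$ with $x_i\in I$ for $1<i<n$ such that either $x_ix_{i+1}\triangleleft^I_G X$ for all odd $i$ and $x_ix_{i+1}\triangleleft^I_H X$ for all even $i$, or the same with $G,H$ swapped; it is complete if $x_1,x_n\notin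 I$. $G\odot_I H$ has vertex set $V=(V_G\cup V_H)\setminus I$ and, for $x\ne y\in V$, $X\subseteq V$, $xy\triangleleft X$ iff there is a complete alternating $X$-labeled path from $x$ to $y$ between $G$ and $H$ through $I$; $\odot_A=\odot_{\mathrm{names}(A)}$. $\mathrm{wk}_\Gamma(G)=\langle V_G\cup\mathrm{names}(\Gamma),\{(e,X\cup Y)\mid e\triangleleft_G X,\,Y\in\mathrm{Br}(\Gamma)\}\rangle$. $\mathrm{id}_{\{\alpha^x,\bar\alpha^y\}}=\langle\{x,y\},\{(xy,\{x,y\})\}\rangle$, and for disjoint sharing-free $A_1\lor A_2$, $\bar B_1\land\bar B_2$ with $A_i\equiv B_i$, $\mathrm{id}_{\{A_1\lor A_2,\bar B_1\land\bar B_2\}}=\mathrm{wk}_{\{A_2\}}(\mathrm{id}_{\{A_1,\bar B_1\}})\sqcup\mathrm{wk}_{\{A_1\}}(\mathrm{id}_{\{A_2,\bar B_2\}})$ (every axiom pair of non-atomic formulas is an unordered pair of this shape). $\langle\!\langle P\rangle\!\rangle$ is $\mathrm{wk}_\Gamma(\mathrm{id}_{\{A,\bar B\}})$ for an axiom $\mathrm{ax}_{\{A,\bar B\}}$ with conclusion $\vdash\Gamma,A,\bar B$; $\langle\!\langle Q\rangle\!\rangle\odot_A\langle\!\langle R\rangle\!\rangle$ for a cut with premiss derivations $Q$ of $\vdash\Gamma,A$, $R$ of $\vdash\Gamma,\bar A$; the union of the premisses' bl-graphs for $\sqcup,\lor,\land$. *)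

(* Defs.v *)
From HB Require Import structures.
From mathcomp Require Import all_boot.
From mathcomp Require Import boolp classical_sets cardinality.

Set Implicit Arguments.
Unset Strict Implicit.
Unset Printing Implicit Defensive.

Local Open Scope classical_set_scope.

Local Obligation Tactic := idtac.

(* [At] is the set of atoms, [N] the set of names. *)
Inductive formula (At N : Type) : Type :=
| Atom of At & N
| Or of formula At N & formula At N
| And of formula At N & formula At N.

Fixpoint fneg (At N : Type) (neg : At -> At) (A : formula At N) :
    formula At N :=
  match A with
  | Atom a x => Atom (neg a) x
  | Or B C => And (fneg neg B) (fneg neg C)
  | And B C => Or (fneg neg B) (fneg neg C)
  end.

Fixpoint erase (At N : Type) (A : formula At N) : formula At unit :=
  match A with
  | Atom a _ => Atom a tt
  | Or B C => Or (erase B) (erase C)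
  | And B C => And (erase B) (erase C)
  end.

Definition same_shape (At N : Type) (A B : formula At N) : Prop :=
  erase A = erase B.

(* The names of [A] from left to right, with repetitions. *)
Fixpoint occs (At : Type) (N : eqType) (A : formula At N) : seq N :=
  match A with
  | Atom _ x => [:: x]
  | Or B C => occs B ++ occs C
  | And B C => occs B ++ occs C
  end.

Definition names (At : Type) (N : eqType) (A : formula At N) : set N :=
  [set` occs A].

Definition names_set (At : Type) (N : eqType) (Gamma : set (formula At N)) :
    set N :=
  \bigcup_(A in Gamma) names A.

Definition sharing_free (At : Type) (N : eqType) (A : formula At N) : bool :=
  uniq (occs A).

Definition sharing_free_set (At : Type) (N : eqType)
    (Gamma : set (formula At N)) : Prop :=
  (forall A, Gamma A -> sharing_free A) /\
  trivIset Gamma (@names At N).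

Definition sequent (At : Type) (N : eqType)
    (Gamma : set (formula At N)) : Prop :=
  finite_set Gamma /\ sharing_free_set Gamma.

Notation "Gamma ,, A" := (Gamma `|` [set A])
  (at level 50, left associativity, only parsing) : classical_set_scope.

(* The proviso that comes with the comma notation in [Gamma ,, A]. *)
Definition apart (At : Type) (N : eqType) (Gamma : set (formula At N))
    (A : formula At N) : Prop :=
  names_set Gamma `&` names A = set0.

Fixpoint Br (At N : Type) (A : formula At N) : set (set N) :=
  match A with
  | Atom _ x => [set [set x]]
  | Or B C => [set X `|` Y | X in Br B & Y in Br C]
  | And B C => Br B `|` Br C
  end.

Definition Br_set (At : Type) (N : eqType) (Gamma : set (formula At N)) :
    set (set N) :=
  [set X | X `<=` names_set Gamma /\
           forall A, Gamma A -> Br A (X `&` names A)].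

(* [link G e X] is "e is an X-labeled edge of G"; [e `<=` verts G] follows
   from the last two conditions of [linkP]. *)
Record blgraph (N : Type) : Type := BlGraph {
  verts : set N;
  link : set N -> set N -> Prop;
  linkP : forall e X, link e X ->
    [/\ exists x y, x <> y /\ e = [set x; y], e `<=` X & X `<=` verts]
}.

(* Leibniz equality of bl-graphs is equality of both components. *)
Lemma blgraph_ext (N : Type) (G H : blgraph N) :
  verts G = verts H -> (forall e X, link G e X <-> link H e X) -> G = H.
Proof.
case: G => V l p; case: H => V' l' p' /= eV el; subst V'.
have ell : l = l' by apply/funext => e; apply/funext => X; exact/propext.
by subst l'; congr BlGraph; exact: Prop_irrelevance.
Qed.

Program Definition graph0 (N : Type) : blgraph N :=
  @BlGraph N set0 (fun _ _ => False) _.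
Next Obligation. by []. Qed.

Program Definition gunion (N : Type) (G H : blgraph N) : blgraph N :=
  @BlGraph N (verts G `|` verts H) (fun e X => link G e X \/ link H e X) _.
Next Obligation.
by move=> N G H e X [] /linkP[pe eX XV]; split=> // z /XV; [left|right].
Qed.

Program Definition wk (At : Type) (N : eqType) (Gamma : set (formula At N))
    (G : blgraph N) : blgraph N :=
  @BlGraph N (verts G `|` names_set Gamma)
    (fun e Z => exists X Y, [/\ link G e X, Br_set Gamma Y & Z = X `|` Y]) _.
Next Obligation.
move=> At N Gamma G e Z [X [Y [/linkP[pe eX XV] [YG _] ->]]]; split=> //.
- by move=> z /eX; left.
- by move=> z [/XV|/YG]; [left|right].
Qed.

(* [x <> y] always holds when the two atomic formulas have disjoint names. *)
Program Definition id_atom (N : Type) (x y : N) : blgraph N :=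
  @BlGraph N [set x; y]
    (fun e X => [/\ x <> y, e = [set x; y] & X = [set x; y]]) _.
Next Obligation.
by move=> N x y e X [xy -> ->]; split=> //; exists x, y.
Qed.

(* [idg A C] is the identity bl-graph on the pair [{A, C}], where [C] is meant
   to be the negation of a formula of the same shape as [A]; the value
   [graph0] is never reached on such pairs. *)
Fixpoint idg (At : Type) (N : eqType) (A C : formula At N) : blgraph N :=
  match A, C with
  | Atom _ x, Atom _ y => id_atom x y
  | Or A1 A2, And C1 C2 =>
      gunion (wk [set A2] (idg A1 C1)) (wk [set A1] (idg A2 C2))
  | And A1 A2, Or C1 C2 =>
      gunion (wk [set C2] (idg A1 C1)) (wk [set C1] (idg A2 C2))
  | _, _ => graph0 N
  end.

Lemma idgC (At : Type) (N : eqType) (A C : formula At N) : idg A C = idg C A.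
Proof.
elim: A C => [a x|A1 IH1 A2 IH2|A1 IH1 A2 IH2] [c y|C1 C2|C1 C2] //=;
  rewrite ?IH1 ?IH2 //.
apply: blgraph_ext => /=; first by rewrite setUC.
by move=> e X; rewrite setUC; split=> -[xy -> ->]; split=> // /esym.
Qed.

Definition link_out (N : Type) (I : set N) (G : blgraph N) (e X : set N) :
    Prop :=
  exists2 Y, link G e Y & X = Y `\` I.

(* The sequence of vertices is [x :: s]. Positions are counted from 0, so the
   edges leaving even positions are in [G] and the others in [H]. *)
Definition alt_path_from (N : eqType) (I : set N) (G H : blgraph N)
    (X : set N) (x : N) (s : seq N) : Prop :=
  forall i, i.+1 < size (x :: s) ->
    link_out I (if odd i then H else G)
      [set nth x (x :: s) i; nth x (x :: s) i.+1] X.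

Definition alt_path (N : eqType) (I : set N) (G H : blgraph N)
    (X : set N) (x : N) (s : seq N) : Prop :=
  [/\ 1 < size (x :: s),
      uniq (x :: s),
      (forall z, z \in x :: s -> (verts G `|` verts H) z),
      (forall i, 0 < i -> i.+1 < size (x :: s) -> I (nth x (x :: s) i)) &
      alt_path_from I G H X x s \/ alt_path_from I H G X x s].

Definition complete_alt_path (N : eqType) (I : set N) (G H : blgraph N)
    (X : set N) (x : N) (s : seq N) : Prop :=
  [/\ alt_path I G H X x s, ~ I x & ~ I (last x s)].

Lemma alt_path_from_ends (N : eqType) (I : set N) (G H : blgraph N)
    (X : set N) (x : N) (s : seq N) :
  1 < size (x :: s) -> ~ I x -> ~ I (last x s) ->
  alt_path_from I G H X x s -> [set x; last x s] `<=` X.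
Proof.
move=> s1 nIx nIl p z [->|->].
- have [Y /linkP[_ sY _] ->] := p 0 s1.
  by split=> //; apply: sY; left.
- have s2 : (size s).-1.+1 < size (x :: s) by rewrite prednK.
  have [Y /linkP[_ sY _] ->] := p _ s2.
  by split=> //; apply: sY; right; rewrite prednK // (last_nth x).
Qed.

Program Definition gcomp (N : eqType) (I : set N) (G H : blgraph N) :
    blgraph N :=
  @BlGraph N ((verts G `|` verts H) `\` I)
    (fun e X => exists x y,
      [/\ x <> y,
          e = [set x; y],
          e `<=` (verts G `|` verts H) `\` I,
          X `<=` (verts G `|` verts H) `\` I &
          exists2 s, complete_alt_path I G H X x s & last x s = y]) _.
Next Obligation.
move=> N I G H e X [x [y [xy -> eV XV [s [[s1 _ _ _ p] nx nl] ly]]]].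
split=> //; first by exists x, y.
by rewrite -ly; case: p => p; exact: alt_path_from_ends p.
Qed.

(* [deriv neg Gamma] is the type of derivations with conclusion [Gamma]. *)
Inductive deriv (At : Type) (N : eqType) (neg : At -> At) :
    set (formula At N) -> Type :=
| Ax (Gamma : set (formula At N)) (A B : formula At N) :
    same_shape A B ->
    apart Gamma A -> apart (Gamma ,, A) (fneg neg B) ->
    sequent (Gamma ,, A ,, fneg neg B) ->
    deriv neg (Gamma ,, A ,, fneg neg B)
| Cut (Gamma : set (formula At N)) (A : formula At N) :
    apart Gamma A -> apart Gamma (fneg neg A) ->
    sequent Gamma ->
    deriv neg (Gamma ,, A) -> deriv neg (Gamma ,, fneg neg A) ->
    deriv neg Gamma
| Sup (Gamma : set (formula At N)) :
    sequent Gamma ->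
    deriv neg Gamma -> deriv neg Gamma ->
    deriv neg Gamma
| OrI (Gamma : set (formula At N)) (A B : formula At N) :
    apart Gamma A -> apart (Gamma ,, A) B ->
    apart Gamma (Or A B) ->
    sequent (Gamma ,, Or A B) ->
    deriv neg (Gamma ,, A ,, B) ->
    deriv neg (Gamma ,, Or A B)
| AndI (Gamma : set (formula At N)) (A B : formula At N) :
    apart Gamma A -> apart Gamma B ->
    apart Gamma (And A B) ->
    sequent (Gamma ,, And A B) ->
    deriv neg (Gamma ,, A) -> deriv neg (Gamma ,, B) ->
    deriv neg (Gamma ,, And A B).

Fixpoint cut_free (At : Type) (N : eqType) (neg : At -> At)
    (Gamma : set (formula At N)) (P : deriv neg Gamma) : bool :=
  match P with
  | Ax _ _ _ _ _ _ _ => true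
  | Cut _ _ _ _ _ _ _ => false
  | Sup _ _ Q R => cut_free Q && cut_free R
  | OrI _ _ _ _ _ _ _ Q => cut_free Q
  | AndI _ _ _ _ _ _ _ Q R => cut_free Q && cut_free R
  end.

Fixpoint interp (At : Type) (N : eqType) (neg : At -> At)
    (Gamma : set (formula At N)) (P : deriv neg Gamma) : blgraph N :=
  match P with
  | Ax Gamma A B _ _ _ _ => wk Gamma (idg A (fneg neg B))
  | Cut _ A _ _ _ Q R => gcomp (names A) (interp Q) (interp R)
  | Sup _ _ Q R => gunion (interp Q) (interp R)
  | OrI _ _ _ _ _ _ _ Q => interp Q
  | AndI _ _ _ _ _ _ _ Q R => gunion (interp Q) (interp R)
  end.

(* Main.v *)
(* A bl-graph [G] is called full on [Gamma] when its vertices are the names of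
   [Gamma], its labels are branches of [Gamma], its edges join occurrences of
   dual atoms, and every branch of [Gamma] labels at least one edge. The graphs
   of derivations, and those of cut-free derivations, are exactly the full ones.

   Full graphs are sequentialized by inverting the rules for disjunction and
   conjunction down to atomic sequents, which have a single branch; there the
   graph is a finite non-empty set of edges, i.e. a superposition of axioms.

   The delicate point in the converse is that a cut leaves an edge over every
   branch [X] of [Gamma]. If no complete alternating path were labeled by [X],
   let [S] and [T] be the names of [A] reached from [X] by alternating paths
   ending in the first, respectively second, graph. They are disjoint. Let [W]
   consist of [S] and of the positive atoms outside [T], for some polarity
   separating each atom from its dual. By De Morgan duality, either some branch
   of [A] avoids [W], and then no edge of the first graph fits in its union with
   [X], or some branch of the negation of [A] is contained in [W], and then no
   edge of the second graph fits; both contradict fullness. *)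
From HB Require Import structures.
Require Import Defs.
From mathcomp Require Import all_boot.
From mathcomp Require Import boolp classical_sets cardinality.

Set Implicit Arguments.
Unset Strict Implicit.
Unset Printing Implicit Defensive.

Local Open Scope classical_set_scope.

(** Classical equality on formulas lets finite sequents be listed as sequences, for an arbitrary
    type of atoms. *)
HB.instance Definition _ (At N : Type) := gen_eqMixin (formula At N).

Lemma set2_inj (T : Type) (u v x y : T) :
  [set u; v] = [set x; y] -> (u = x /\ v = y) \/ (u = y /\ v = x).
Proof.
move=> e.
have hu : [set x; y] u by rewrite -e; left.
have hv : [set x; y] v by rewrite -e; right.
have hx : [set u; v] x by rewrite e; left.
have hy : [set u; v] y by rewrite e; right.
by case: hu => /= ?; case: hv => /= ?; case: hx => /= ?; case: hy => /= ?;
  ((left; split; congruence) || (right; split; congruence)).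
Qed.

(** * Names and branches of formulas and sequents *)

Section Branches.
Variables (At : Type) (N : eqType).
Implicit Types (A B : formula At N) (Gamma : set (formula At N)).
Implicit Types (X Y Z W : set N).

Lemma names_Or A B : names (Or A B) = names A `|` names B.
Proof.
apply/seteqP; split=> x; rewrite /names /= mem_cat.
  by case/orP; [left|right].
by case=> ->; rewrite ?orbT.
Qed.

Lemma names_And A B : names (And A B) = names A `|` names B.
Proof. exact: names_Or. Qed.

Lemma names_Atom a x : names (Atom a x : formula At N) = [set x].
Proof. by apply/seteqP; split=> y; rewrite /names /= inE => /eqP. Qed.

Lemma occs_fneg neg A : occs (fneg neg A) = occs A.
Proof. by elim: A => //= A -> B ->. Qed.

Lemma names_fneg neg A : names (fneg neg A) = names A.
Proof. by rewrite /names occs_fneg. Qed.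

Lemma names_setU1 Gamma A :
  names_set (Gamma ,, A) = names_set Gamma `|` names A.
Proof. by rewrite /names_set bigcup_setU bigcup_set1. Qed.

Lemma names_set1 A : names_set [set A] = names A.
Proof. exact: bigcup_set1. Qed.

Lemma apartP Gamma A x : apart Gamma A -> names_set Gamma x -> ~ names A x.
Proof. by move=> ap Gx Ax; have : set0 x by rewrite -ap. Qed.

Lemma Br_names A X : Br A X -> X `<=` names A.
Proof.
elim: A X => [a x|A IHA B IHB|A IHA B IHB] X /=.
- by move=> ->; rewrite names_Atom.
- rewrite names_Or => -[Y /IHA YA [Z /IHB ZB <-]].
  exact: setUSS.
- by rewrite names_And => -[/IHA|/IHB] XA z /XA; [left|right].
Qed.

(* The branches of [A] are the clauses of its conjunctive normal form: this is
   excluded middle for the valuation that makes the names in [W] true. *)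
Lemma Br_dual neg A W :
  (exists2 Z, Br A Z & Z `&` W = set0) \/
  (exists2 Z, Br (fneg neg A) Z & Z `<=` W).
Proof.
elim: A => [a x|A IHA B IHB|A IHA B IHB] /=.
- have [Wx|nWx] := pselect (W x); [right|left]; exists [set x] => //.
    by move=> _ ->.
  by apply/seteqP; split=> // _ [->].
- case: IHA => [[Y AY YW]|[Y AY YW]]; last by right; exists Y => //; left.
  case: IHB => [[Z BZ ZW]|[Z BZ ZW]]; last by right; exists Z => //; right.
  left; exists (Y `|` Z); first by exists Y => //; exists Z.
  by rewrite setIUl YW ZW setU0.
- case: IHA => [[Y AY YW]|[Y AY YW]]; first by left; exists Y => //; left.
  case: IHB => [[Z BZ ZW]|[Z BZ ZW]]; first by left; exists Z => //; right.
  right; exists (Y `|` Z); first by exists Y => //; exists Z.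
  by rewrite subUset.
Qed.

Lemma Br_set1 A : Br_set [set A] = Br A.
Proof.
apply/seteqP; split=> X.
  rewrite /Br_set /= names_set1 => -[XA /(_ A erefl)].
  by have -> : X `&` names A = X by apply/setIidPl.
move=> AX; split; first by rewrite names_set1; exact: Br_names.
by move=> _ ->; have -> : X `&` names A = X by apply/setIidPl/Br_names.
Qed.

(** The names of [Gamma] and [A] are disjoint, so the traces of a branch on the two sides can be
    chosen independently. *)
Lemma Br_setU1 Gamma A : apart Gamma A ->
  Br_set (Gamma ,, A) = [set Y `|` Z | Y in Br_set Gamma & Z in Br A].
Proof.
move=> ap; apply/seteqP; split=> X.
  rewrite /Br_set /= names_setU1 => -[XGA brX].
  exists (X `&` names_set Gamma); last first.
    exists (X `&` names A); first by apply: brX; right.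
    by rewrite -setIUr; apply/setIidPl.
  split=> [z []//|B GB].
  suff -> : X `&` names_set Gamma `&` names B = X `&` names B.
    by apply: brX; left.
  by rewrite -setIA; congr (_ `&` _); apply/setIidPr => z Bz; exists B.
move=> [Y [YG brY] [Z /[dup] brZ /Br_names ZA <-]].
split; first by rewrite names_setU1; exact: setUSS.
move=> B [GB|->]; rewrite setIUl.
  suff -> : Z `&` names B = set0 by rewrite setU0; exact: brY.
  apply/seteqP; split=> // z [/ZA Az Bz]; apply: (apartP ap _ Az).
  by exists B.
suff -> : Y `&` names A = set0.
  by rewrite set0U; have -> : Z `&` names A = Z by apply/setIidPl.
by apply/seteqP; split=> // z [/YG Gz Az]; apply: (apartP ap Gz Az).
Qed.

Lemma apartUr Gamma A B :
  apart (Gamma ,, A) B <-> apart Gamma B /\ names A `&` names B = set0.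
Proof. by rewrite /apart names_setU1 setIUl setU_eq0. Qed.

Lemma Br_set_Or Gamma A B :
  apart Gamma A -> apart (Gamma ,, A) B -> apart Gamma (Or A B) ->
  Br_set (Gamma ,, Or A B) = Br_set (Gamma ,, A ,, B).
Proof.
move=> apA apB apAB; rewrite !Br_setU1 //; apply/seteqP; split=> X.
  move=> [Y GY [_ [ZA AZ [ZB BZ <-]] <-]].
  exists (Y `|` ZA); first by exists Y => //; exists ZA.
  by exists ZB => //; rewrite setUA.
move=> [_ [Y GY [ZA AZ <-]] [ZB BZ <-]].
exists Y => //; exists (ZA `|` ZB); last by rewrite setUA.
by exists ZA => //; exists ZB.
Qed.

(** A branch of a conjunction picks one conjunct; this later lets a graph be split along its
    labels. *)
Lemma Br_set_And Gamma A B :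
  apart Gamma A -> apart Gamma B -> apart Gamma (And A B) ->
  Br_set (Gamma ,, And A B) = Br_set (Gamma ,, A) `|` Br_set (Gamma ,, B).
Proof.
move=> apA apB apAB; rewrite !Br_setU1 //; apply/seteqP; split=> X.
  by move=> [Y GY [Z [AZ|BZ] <-]]; [left|right]; exists Y => //; exists Z.
by move=> [[Y GY [Z AZ <-]]|[Y GY [Z BZ <-]]]; exists Y => //; exists Z => //;
  [left|right].
Qed.

End Branches.

(** * Atoms attached to names *)

Section Labels.
Variables (At : Type) (N : eqType).
Implicit Types (A B : formula At N) (Gamma : set (formula At N)).
Implicit Types (a b : At) (x y : N).

(** As a relation it needs no default atom for names outside [A]; sharing-freeness makes it
    functional. *)
Fixpoint labels A : At -> N -> Prop :=
  match A with
  | Atom a x => fun b y => a = b /\ x = y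
  | Or B C => fun b y => labels B b y \/ labels C b y
  | And B C => fun b y => labels B b y \/ labels C b y
  end.

Definition labels_set Gamma a x := exists2 A, Gamma A & labels A a x.

Lemma labels_setU1 Gamma A a x :
  labels_set (Gamma ,, A) a x <-> labels_set Gamma a x \/ labels A a x.
Proof.
split=> [[B [GB|->] Bx]|[[B GB Bx]|Ax]].
- by left; exists B.
- by right.
- by exists B => //; left.
- by exists A => //; right.
Qed.

Lemma labels_names A a x : labels A a x -> names A x.
Proof.
elim: A => [b y [_ ->]|A IHA B IHB|A IHA B IHB] /=; first by rewrite names_Atom.
  by rewrite names_Or => -[/IHA|/IHB]; [left|right].
by rewrite names_And => -[/IHA|/IHB]; [left|right].
Qed.

Lemma labels_set_names Gamma a x : labels_set Gamma a x -> names_set Gamma x.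
Proof. by move=> [A GA /labels_names]; exists A. Qed.

Lemma labels_fneg neg A a x : labels A a x -> labels (fneg neg A) (neg a) x.
Proof.
elim: A => [b y [-> ->]//|A IHA B IHB|A IHA B IHB] /=;
  by case=> [/IHA|/IHB]; [left|right].
Qed.

Lemma fnegK neg : involutive neg -> involutive (@fneg At N neg).
Proof.
move=> negK; elim=> [a x|A IHA B IHB|A IHA B IHB] /=; first by rewrite negK.
  by rewrite IHA IHB.
by rewrite IHA IHB.
Qed.

Lemma labels_inj A a b x :
  sharing_free A -> labels A a x -> labels A b x -> a = b.
Proof.
have disj B C :
    ~~ has (mem (occs B)) (occs C) -> labels B a x -> ~ labels C b x.
  move=> /hasPn BC /labels_names Bx /labels_names Cx.
  by move: (BC _ Cx); rewrite /= (Bx : x \in occs B).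
have disjC B C :
    ~~ has (mem (occs B)) (occs C) -> labels C a x -> ~ labels B b x.
  move=> /hasPn BC /labels_names Cx /labels_names Bx.
  by move: (BC _ Cx); rewrite /= (Bx : x \in occs B).
elim: A => [c y _ [<- _] [<- _]//|A IHA B IHB|A IHA B IHB];
  rewrite /sharing_free /= cat_uniq => /and3P[uA AB uB] [Aa|Ba] [Ab|Bb].
all: by [apply: IHA|apply: IHB|case: (disj A B AB Aa Bb)|case: (disjC A B AB Ba Ab)].
Qed.

Lemma labels_set_inj Gamma a b x : sharing_free_set Gamma ->
  labels_set Gamma a x -> labels_set Gamma b x -> a = b.
Proof.
move=> [sf tr] [A GA Aa] [B GB Bb].
have AB : A = B.
  by apply: tr => //; exists x; split; [exact: labels_names Aa|exact: labels_names Bb].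
by subst B; exact: labels_inj (sf _ GA) Aa Bb.
Qed.

End Labels.

(** * Full graphs *)

Section Full.
Variables (At : Type) (N : eqType) (neg : At -> At).
Hypothesis negK : involutive neg.
Implicit Types (A B C : formula At N) (Gamma : set (formula At N)).
Implicit Types (X Y Z V : set N) (BB : set (set N)) (L : At -> N -> Prop).
Implicit Types (G H : blgraph N).

(* [full] for the typing of names [L], the branches [BB] and the names [V]. *)
Record full L BB V G : Prop := Full {
  full_verts : verts G = V;
  full_br : forall e X, link G e X -> BB X;
  full_dual : forall u v X, link G [set u; v] X ->
    exists2 a, L a u & L (neg a) v;
  full_ex : forall X, BB X -> exists e, link G e X
}.

Definition full_on Gamma :=
  full (labels_set Gamma) (Br_set Gamma) (names_set Gamma).

Lemma full_union L L1 L2 BB1 BB2 V1 V2 G H :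
  (forall a x, L1 a x -> L a x) -> (forall a x, L2 a x -> L a x) ->
  full L1 BB1 V1 G -> full L2 BB2 V2 H ->
  full L (BB1 `|` BB2) (V1 `|` V2) (gunion G H).
Proof.
move=> s1 s2 [vG bG dG eG] [vH bH dH eH]; split=> /=.
- by rewrite vG vH.
- by move=> e X [/bG|/bH]; [left|right].
- by move=> u v X [/dG|/dH] [a au av]; exists a; auto.
- by move=> X [/eG|/eH] [e ?]; exists e; [left|right].
Qed.

(* [full_pair A C] is [full_on [set A; C]], except that branches of the two formulas
   are combined even if [A] and [C] share names. *)
Definition full_pair A C :=
  full (fun a x => labels A a x \/ labels C a x)
    [set Y `|` Z | Y in Br A & Z in Br C] (names A `|` names C).

Lemma full_pairC A C G : full_pair A C G -> full_pair C A G.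
Proof.
have brE : [set Y `|` Z | Y in Br A & Z in Br C] =
           [set Y `|` Z | Y in Br C & Z in Br A].
  by apply/seteqP; split=> X [Y bY [Z bZ <-]]; exists Z => //; exists Y => //;
     rewrite setUC.
rewrite /full_pair brE setUC => -[vG bG dG eG]; split=> // u v X /dG.
by move=> [a [] au [] av]; exists a; auto.
Qed.

Lemma full_pair_atom a x y : x <> y ->
  full_pair (Atom a x) (Atom (neg a) y) (id_atom x y).
Proof.
move=> xy; split=> /=.
- by rewrite !names_Atom.
- by move=> e X [_ _ ->]; exists [set x] => //; exists [set y].
- move=> u v X [_ uv _]; case: (set2_inj uv) => -[-> ->].
    by exists a; [left|right].
  by exists (neg a); [right|left; rewrite negK].
- by move=> _ [_ -> [_ -> <-]]; exists [set x; y].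
Qed.

(** A branch of the pair takes branches of [A1] and [A2] and a branch of either [C1] or [C2]; this
    last choice decides which of the two weakened graphs supplies the edge. *)
Lemma full_pair_Or A1 A2 C1 C2 G1 G2 :
  full_pair A1 C1 G1 -> full_pair A2 C2 G2 ->
  full_pair (Or A1 A2) (And C1 C2)
    (gunion (wk [set A2] G1) (wk [set A1] G2)).
Proof.
move=> [v1 b1 d1 e1] [v2 b2 d2 e2]; split=> /=.
- rewrite v1 v2 !names_set1 names_Or names_And.
  by apply/seteqP; split=> z /=; tauto.
- move=> e X [] [Y [Z [l + ->]]]; rewrite Br_set1 => bZ.
    have [Y1 bY1 [Y2 bY2 <-]] := b1 _ _ l.
    exists (Y1 `|` Z); first by exists Y1 => //; exists Z.
    by exists Y2; [left|rewrite setUAC].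
  have [Y1 bY1 [Y2 bY2 <-]] := b2 _ _ l.
  exists (Z `|` Y1); first by exists Z => //; exists Y1.
  by exists Y2; [right|rewrite -setUA setUC].
- move=> u v X [] [Y [Z [l _ _]]].
    by have [a au av] := d1 _ _ _ l; exists a; tauto.
  by have [a au av] := d2 _ _ _ l; exists a; tauto.
- move=> _ [_ [Y1 bY1 [Y2 bY2 <-]] [Z [bZ|bZ] <-]].
    have [|e le] := e1 (Y1 `|` Z); first by exists Y1 => //; exists Z.
    exists e; left; exists (Y1 `|` Z), Y2.
    by rewrite Br_set1; split=> //; rewrite setUAC.
  have [|e le] := e2 (Y2 `|` Z); first by exists Y2 => //; exists Z.
  exists e; right; exists (Y2 `|` Z), Y1.
  by rewrite Br_set1; split=> //; rewrite -setUA setUC.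
Qed.

Lemma full_idg A B : same_shape A B -> names A `&` names B = set0 ->
  full_pair A (fneg neg B) (idg A (fneg neg B)).
Proof.
rewrite /same_shape.
elim: A B => [a x|A1 IH1 A2 IH2|A1 IH1 A2 IH2] [b y|B1 B2|B1 B2] //=.
- move=> [<-]; rewrite !names_Atom => xy; apply: full_pair_atom => exy.
  by have : set0 x by rewrite -xy exy.
- move=> [e1 e2]; rewrite !names_Or setIUr !setIUl !setU_eq0 => -[[d1 _] [_ d2]].
  by apply: full_pair_Or; [exact: IH1|exact: IH2].
- move=> [e1 e2]; rewrite !names_And setIUr !setIUl !setU_eq0 => -[[d1 _] [_ d2]].
  (* Swapping the pair reduces this case to the previous one. *)
  by apply: full_pairC; apply: full_pair_Or; apply: full_pairC; [exact: IH1|exact: IH2].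
Qed.

Lemma full_wk Gamma A C G :
  apart Gamma A -> apart (Gamma ,, A) C ->
  full_pair A C G -> full_on (Gamma ,, A ,, C) (wk Gamma G).
Proof.
move=> apA apC [vG bG dG eG]; split=> /=.
- by rewrite vG !names_setU1 setUC setUA.
- move=> e X [Y [Z [/bG[Y1 bY1 [Y2 bY2 <-]] bZ ->]]]; rewrite !Br_setU1 //.
  exists (Z `|` Y1); first by exists Z => //; exists Y1.
  by exists Y2 => //; rewrite -setUA setUC.
- move=> u v X [Y [Z [l _ _]]]; have [a au av] := dG _ _ _ l.
  by exists a; rewrite !labels_setU1; tauto.
- move=> X; rewrite !Br_setU1 // => -[_ [Z bZ [Y1 bY1 <-]] [Y2 bY2 <-]].
  have [|e le] := eG (Y1 `|` Y2); first by exists Y1 => //; exists Y2.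
  by exists e, (Y1 `|` Y2), Z; split=> //; rewrite -setUA setUC.
Qed.

Lemma full_Or Gamma A B :
  apart Gamma A -> apart (Gamma ,, A) B -> apart Gamma (Or A B) ->
  full_on (Gamma ,, Or A B) = full_on (Gamma ,, A ,, B).
Proof.
move=> apA apB apAB; rewrite /full_on Br_set_Or // !names_setU1 names_Or setUA.
suff -> : labels_set (Gamma ,, Or A B) = labels_set (Gamma ,, A ,, B) by [].
by apply/funext => a; apply/funext => x; rewrite propeqE !labels_setU1 /=; tauto.
Qed.

Lemma full_And Gamma A B G H :
  apart Gamma A -> apart Gamma B -> apart Gamma (And A B) ->
  full_on (Gamma ,, A) G -> full_on (Gamma ,, B) H ->
  full_on (Gamma ,, And A B) (gunion G H).
Proof.
move=> apA apB apAB fG fH; rewrite /full_on Br_set_And //.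
have -> : names_set (Gamma ,, And A B) =
    names_set (Gamma ,, A) `|` names_set (Gamma ,, B).
  by rewrite !names_setU1 names_And setUUr.
by apply: full_union fG fH => a x; rewrite !labels_setU1 /=; tauto.
Qed.

Lemma full_Sup Gamma G H :
  full_on Gamma G -> full_on Gamma H -> full_on Gamma (gunion G H).
Proof.
move=> fG fH; rewrite /full_on -(setUid (Br_set _)) -(setUid (names_set _)).
exact: full_union fG fH.
Qed.

(** * Polarities of atoms *)

Hypothesis neg_neq : forall a : At, neg a <> a.

(** The set of [a] and [neg a] is unchanged by [neg], so both atoms see the same chosen
    representative, which is declared positive. *)
Lemma exists_polarity :
  exists pol : At -> bool, forall a, pol (neg a) = ~~ pol a.
Proof.
have [rep repP] : exists rep : set At -> option At,
    forall a, rep [set a; neg a] = Some a \/ rep [set a; neg a] = Some (neg a).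
  (* [None] is the value at the empty set, where there is no atom to choose. *)
  have /choice[rep repP] : forall S : set At, exists o : option At,
      S !=set0 -> exists2 a, S a & o = Some a.
    move=> S; have [[a Sa]|nS] := pselect (S !=set0); last by exists None.
    by exists (Some a) => _; exists a.
  exists rep => a; have [|_ [->|->] ->] := repP [set a; neg a]; [|by left|by right].
  by exists a; left.
exists (fun a => `[< rep [set a; neg a] = Some a >]) => a.
have -> : [set neg a; neg (neg a)] = [set a; neg a] by rewrite negK setUC.
have nE : Some a <> Some (neg a) by move=> [/esym]; exact: neg_neq.
case: (repP a) => ->; first by rewrite asboolF ?asboolT.
by rewrite asboolT ?asboolF //; exact/nesym.
Qed.

(** * Composition of full graphs *)

Section Cut.
Variables (Gamma : set (formula At N)) (A : formula At N).
Hypotheses (apA : apart Gamma A) (apC : apart Gamma (fneg neg A)).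
Hypotheses (seqA : sequent (Gamma ,, A)) (seqC : sequent (Gamma ,, fneg neg A)).
Variables G H : blgraph N.
Hypotheses (fullG : full_on (Gamma ,, A) G).
Hypotheses (fullH : full_on (Gamma ,, fneg neg A) H).
Variable X : set N.

(* The two premisses are indexed by booleans, [false] being that of [G]. *)
Let I := names A.
Let form (b : bool) := if b then fneg neg A else A.
Let gr (b : bool) := if b then H else G.
Let lab (b : bool) := labels_set (Gamma ,, form b).
Let E (b : bool) (u v : N) := link_out I (gr b) [set u; v] X.

Let lab_inj b a c x : lab b a x -> lab b c x -> a = c.
Proof. by apply: labels_set_inj; case: b; [case: seqC|case: seqA]. Qed.

Let E_sym b u v : E b u v -> E b v u.
Proof. by rewrite /E setUC. Qed.

Let full_gr b : full_on (Gamma ,, form b) (gr b).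
Proof. by case: b. Qed.

Let E_dual b u v : E b u v -> exists2 a, lab b a u & lab b (neg a) v.
Proof. by move=> [Y /(full_dual (full_gr b))]. Qed.

Let E_lab b a u v : E b u v -> lab b a u -> lab b (neg a) v.
Proof. by move=> /E_dual[c cu cv] /(lab_inj cu) <-. Qed.

Let E_verts b u v : E b u v -> verts (gr b) u /\ verts (gr b) v.
Proof. by move=> [Y /linkP[_ uvY YV] _]; split; apply/YV/uvY; [left|right]. Qed.

Let names_form b : names (form b) = I.
Proof. by case: b; rewrite //= names_fneg. Qed.

(** Changing graphs at an inner name dualizes its atom, since the cut formulas are negations of each
    other. *)
Let lab_in b a x : I x -> lab b a x -> lab (~~ b) (neg a) x.
Proof.
move=> Ix /labels_setU1[Gx|].
  by case: (apartP apA (labels_set_names Gx)).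
move=> bx; apply/labels_setU1; right.
by case: b bx => /= /(labels_fneg neg); rewrite ?fnegK.
Qed.

Let lab_out b a x : ~ I x -> lab b a x -> labels_set Gamma a x.
Proof.
move=> nIx /labels_setU1[//|bx]; case: nIx.
by rewrite -(names_form b); exact: labels_names bx.
Qed.

(** Recursive form of [alt_path_from], the boolean telling the graph of the next edge. *)
Fixpoint walk b x s : Prop :=
  if s is y :: s' then E b x y /\ walk (~~ b) y s' else True.

Let walkP b x s : alt_path_from I (gr b) (gr (~~ b)) X x s <-> walk b x s.
Proof.
elim: s b x => [|y s IHs] b x /=; first by split=> // _ [].
have nthE i : i < size (y :: s) -> nth x (y :: s) i = nth y (y :: s) i.
  exact: set_nth_default.
rewrite -IHs negbK; split=> [p|[xy p] [//|i] si].
  split=> [|i si]; first exact: (p 0).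
  by have := p i.+1 si; rewrite -(nthE _ (ltnW si)) -(nthE _ si) /= if_neg.
have {}si : i.+1 < size (y :: s) := si.
by have := p i si; rewrite -(nthE _ (ltnW si)) -(nthE _ si) /= if_neg.
Qed.

Let walk_verts b x y s z : walk b x (y :: s) -> z \in [:: x, y & s] ->
  (verts G `|` verts H) z.
Proof.
have V c : verts (gr c) `<=` verts G `|` verts H.
  by case: c => ? ?; [right|left].
elim: s b x y => [|y' s IHs] b x y /= [/E_verts[Vx Vy] w].
  by rewrite !inE => /orP[]/eqP->; apply: V; [exact: Vx|exact: Vy].
by rewrite inE => /predU1P[->|]; [apply: V; exact: Vx|exact: IHs w].
Qed.

Let complete_walk b x s y : walk b x (rcons s y) -> uniq (x :: rcons s y) ->
  {in s, forall z, I z} -> ~ I x -> ~ I y ->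
  complete_alt_path I G H X x (rcons s y).
Proof.
move=> w us sI nIx nIy; split=> //; last by rewrite last_rcons.
split=> //.
- by rewrite /= size_rcons.
- by move=> z; case: s w {us sI} => [|x' s] w; exact: walk_verts w.
- move=> [//|i] _ /=; rewrite size_rcons !ltnS => si.
  by rewrite nth_rcons si; apply/sI/mem_nth.
- by move: w => /walkP; case: b => ?; [right|left].
Qed.

(** Each edge dualizes the atom and each change of graph dualizes it back; with one more edge than
    changes, the ends carry dual atoms. *)
Let walk_dual b x s y a : walk b x (rcons s y) -> {in s, forall z, I z} ->
  lab b a x -> ~ I y -> labels_set Gamma (neg a) y.
Proof.
elim: s b x => [|z s IHs] b x /= [xz w] sI ax nIy.
  exact: lab_out nIy (E_lab xz ax).
apply: IHs w _ _ nIy => [t ts|]; first by apply: sI; rewrite inE ts orbT.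
rewrite -(negK a); apply: lab_in; last exact: E_lab xz ax.
by apply: sI; rewrite mem_head.
Qed.

Let complete_path x s : complete_alt_path I G H X x s ->
  exists b s' y, [/\ s = rcons s' y, walk b x s & {in s', forall z, I z}].
Proof.
move=> [[s1 us _ sI p] nIx nIl].
case/lastP: s s1 us sI p nIl => [//|s y] _ us sI p _.
have [b w] : exists b, walk b x (rcons s y).
  by case: p => [p|p]; [exists false|exists true]; apply/walkP.
exists b, s, y; split=> // z zs.
have := sI (index z s).+1 isT; rewrite /= nth_rcons index_mem zs nth_index //.
by apply; rewrite size_rcons !ltnS index_mem.
Qed.

(** A state [(b, z)] records that the inner name [z] was just entered by an edge of graph [b].
    Alternating walks thus become paths of a relation, to which [shortenP] applies. *)
Let step (p q : bool * N) :=
  [&& q.1 == ~~ p.1, `[< E q.1 p.2 q.2 >], `[< I p.2 >] & `[< I q.2 >]].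

Let stepP p q :
  reflect [/\ q.1 = ~~ p.1, E q.1 p.2 q.2, I p.2 & I q.2] (step p q).
Proof. by apply: (iffP and4P) => -[/eqP ? /asboolP ? /asboolP ? /asboolP ?]. Qed.

Let path_walk q p y : path step q p -> E (~~ (last q p).1) (last q p).2 y ->
  walk (~~ q.1) q.2 (rcons (map snd p) y).
Proof.
elim: p q => [|r p IHp] q //= /andP[/stepP[qr rE _ _] rp] yE.
by rewrite -qr; split=> //; exact: IHp.
Qed.

(* The label at the start of an alternating path determines in which of the two
   graphs a given inner vertex is entered, so a walk without repeated states has
   no repeated vertices. *)
Let path_lab a q p : I q.2 -> lab q.1 a q.2 -> path step q p ->
  {in q :: p, forall r, I r.2 /\ lab r.1 a r.2}.
Proof.
elim: p q => [|r p IHp] q Iq aq /=.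
  by move=> _ r; rewrite inE => /eqP->.
move=> /andP[/stepP[qr rE _ Ir] rp] t; rewrite inE => /predU1P[->//|].
apply: IHp => //; rewrite -(negK a); apply: E_lab rE _.
by rewrite qr; exact: lab_in.
Qed.

(** The ends must differ, as an edge of [gcomp] demands. *)
Definition has_complete_path :=
  exists x s, complete_alt_path I G H X x s /\ last x s <> x.

Let complete_edge b x y : E b x y -> ~ I x -> ~ I y -> has_complete_path.
Proof.
move=> xyE nIx nIy; have [a ax ay] := E_dual xyE.
have yx : y <> x.
  by move=> yx; rewrite yx in ay; apply: (@neg_neq a); exact: lab_inj ay ax.
exists x, [:: y]; split=> //; apply: (@complete_walk b x [::]) => //.
by rewrite /= inE andbT; apply/eqP => /esym.
Qed.

(** It suffices to remove repeated states: the typing of names excludes every other coincidence of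
    vertices, including that of the two ends. *)
Let complete_steps b x z p y : ~ I x -> E b x z -> I z -> path step (b, z) p ->
  E (~~ (last (b, z) p).1) (last (b, z) p).2 y -> ~ I y -> has_complete_path.
Proof.
move=> nIx xz Iz + + nIy => /shortenP[{}p bzp up _] yE.
have [a ax az] := E_dual xz.
have pl := @path_lab _ (b, z) p Iz az bzp.
have w : walk b x (rcons (z :: map snd p) y).
  by split=> //; exact: (@path_walk (b, z)).
have pI : {in z :: map snd p, forall t, I t}.
  move=> t; rewrite -[z :: _]/(map snd ((b, z) :: p)) => /mapP[r /pl[Ir _] ->].
  exact: Ir.
(* Otherwise one outer name would carry both [a] and [neg a]. *)
have yx : y <> x.
  move=> yx; have := walk_dual w pI ax nIy; rewrite yx => nax.
  apply: (@neg_neq a); apply: (@lab_inj b _ _ x) => //.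
  by apply/labels_setU1; left.
exists x, (rcons (z :: map snd p) y); split; last by rewrite last_rcons.
apply: (complete_walk w _ pI nIx nIy).
rewrite cons_uniq mem_rcons inE negb_or rcons_uniq -andbA; apply/and4P; split.
- by apply/eqP => /esym.
- by apply/negP => /pI.
- by apply/negP => /pI.
- rewrite -[z :: _]/(map snd ((b, z) :: p)) map_inj_in_uniq //.
  move=> [c t] [c' t'] /pl[/= It ct] /pl[_ /= ct'] /= tt'.
  congr pair => //; apply: contrapT => cc'; subst t'.
  have {}cc' : c' = ~~ c by case: (c) (c') cc' => [] [].
  rewrite {}cc' in ct'.
  exact: (@neg_neq (neg a)) (lab_inj (lab_in It ct) ct').
Qed.

(* [arr false] and [arr true] are the sets [S] and [T] of the introduction. *)
Let arr b z := exists b0 x z0 p,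
  [/\ ~ I x, E b0 x z0, I z0, path step (b0, z0) p & last (b0, z0) p = (b, z)].

Let arr_base b x z : ~ I x -> E b x z -> I z -> arr b z.
Proof. by move=> nIx xz Iz; exists b, x, z, [::]. Qed.

Let arr_step b z t : arr b z -> I z -> E (~~ b) z t -> I t -> arr (~~ b) t.
Proof.
move=> [b0 [x [z0 [p [nIx xz0 Iz0 sp lp]]]]] Iz zt It.
exists b0, x, z0, (rcons p (~~ b, t)); split=> //; last by rewrite last_rcons.
by rewrite rcons_path sp lp; apply/stepP.
Qed.

Let arr_out b z y : arr b z -> E (~~ b) z y -> ~ I y -> has_complete_path.
Proof.
move=> [b0 [x [z0 [p [nIx xz0 Iz0 sp lp]]]]] zy.
by apply: complete_steps nIx xz0 Iz0 sp _; rewrite lp.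
Qed.

(** Steps can be retraced: an arrival at the last vertex through the opposite graph continues back
    to the first one. *)
Let arr_rev q p : path step q p ->
  arr (~~ (last q p).1) (last q p).2 -> arr (~~ q.1) q.2.
Proof.
elim: p q => [//|r p IHp] q /= /andP[/stepP[qr rE Iq Ir] rp] /(IHp _ rp).
rewrite qr negbK => qa; apply: arr_step qa Ir _ Iq.
by rewrite -qr; exact: E_sym.
Qed.

(** The walk arriving through [~~ b] is continued backwards along the one arriving through [b], out
    to the outer name where the latter began. *)
Let arr_disj b z : arr b z -> arr (~~ b) z -> has_complete_path.
Proof.
move=> [b0 [x [z0 [p [nIx xz0 Iz0 sp lp]]]]] zb.
have : arr (~~ b0) z0 by apply: (arr_rev sp); rewrite lp.
by move=> /arr_out; apply; rewrite ?negbK //; [exact: E_sym xz0|].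
Qed.

Lemma complete_path_ex : Br_set Gamma X -> has_complete_path.
Proof.
move=> brX; apply: contrapT => nc.
have [pol polN] := exists_polarity.
(* Polarity is read in the first premiss; at inner names the second premiss carries the dual atoms,
   of opposite polarity. *)
pose pos z := exists2 a, lab false a z & pol a.
have posE a z : lab false a z -> pos z -> pol a.
  by move=> az [c cz]; rewrite (lab_inj az cz).
have pos_ex u v : E false u v -> pos u \/ pos v.
  move=> /E_dual[a au av]; have [pa|pa] := boolP (pol a); first by left; exists a.
  by right; exists (neg a); rewrite ?polN.
have neg_ex u v : E true u v -> I u -> I v -> ~ pos u \/ ~ pos v.
  move=> /E_dual[a /lab_in au /lab_in av] /au{}au /av{}av.
  have [pa|pa] := boolP (pol a).
    by left=> /(posE _ _ au); rewrite polN pa.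
  by right=> /(posE _ _ av); rewrite !polN negbK (negbTE pa).
pose W z := arr false z \/ (pos z /\ ~ arr true z).
have nW z : I z -> ~ W z -> pos z -> arr true z.
  by move=> Iz nWz pz; apply: contrapT => nTz; apply: nWz; right.
have WT z : W z -> ~ arr true z.
  by move=> [Sz|[]//] Tz; apply: nc; exact: arr_disj Sz Tz.
(* A positive inner end outside [W] is in [arr true], so the edge carries an inner other end into
   [arr false], hence into [W]. If one end is outer, the inner one is in [arr false] at once. *)
have noG u v : E false u v -> (I u -> ~ W u) -> (I v -> ~ W v) -> False.
  wlog : u v / I u /\ (~ I v \/ pos u).
    move=> wl uv nWu nWv.
    have [Iu|nIu] := pselect (I u); have [Iv|nIv] := pselect (I v).
    - have [pu|pv] := pos_ex _ _ uv.
        by apply: wl uv nWu nWv; tauto.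
      by apply: wl (E_sym uv) nWv nWu; tauto.
    - by apply: wl uv nWu nWv; tauto.
    - by apply: wl (E_sym uv) nWv nWu; tauto.
    - by apply: nc; exact: complete_edge uv nIu nIv.
  move=> [Iu ivu] uv /(_ Iu) nWu nWv.
  have [Iv|nIv] := pselect (I v).
    case: ivu => [//|pu]; apply: (nWv Iv); left.
    exact: arr_step (nW _ Iu nWu pu) Iu uv Iv.
  by apply: nWu; left; exact: arr_base nIv (E_sym uv) Iu.
(* Dually, a nonpositive end in [W] is in [arr false], so the edge carries an inner other end into
   [arr true], which [W] avoids. *)
have noH u v : E true u v -> (I u -> W u) -> (I v -> W v) -> False.
  wlog : u v / I u /\ (~ I v \/ ~ pos u).
    move=> wl uv Wu Wv.
    have [Iu|nIu] := pselect (I u); have [Iv|nIv] := pselect (I v).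
    - have [pu|pv] := neg_ex _ _ uv Iu Iv.
        by apply: wl uv Wu Wv; tauto.
      by apply: wl (E_sym uv) Wv Wu; tauto.
    - by apply: wl uv Wu Wv; tauto.
    - by apply: wl (E_sym uv) Wv Wu; tauto.
    - by apply: nc; exact: complete_edge uv nIu nIv.
  move=> [Iu ivu] uv /(_ Iu) Wu Wv.
  have [Iv|nIv] := pselect (I v); last first.
    by apply: (WT _ Wu); exact: arr_base nIv (E_sym uv) Iu.
  case: ivu Wu => [//|npu] [Su|[]//]; apply: (WT _ (Wv Iv)).
  exact: arr_step Su Iu uv Iv.
have XI z : X z -> ~ I z by case: brX => XG _ /XG Gz; exact: apartP apA Gz.
(* Fullness gives an edge over the union of [X] and [Z]; as [X] has no inner name, the inner ends
   lie in [Z]. *)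
have edge b Z : Br (form b) Z ->
    exists u v, [/\ E b u v, I u -> Z u & I v -> Z v].
  move=> bZ; have ZI : Z `<=` I by rewrite -(names_form b); exact: Br_names.
  have [|e le] := full_ex (full_gr b) (X := X `|` Z).
    by rewrite Br_setU1; [exists X => //; exists Z|case: (b)].
  have [[u [v [_ euv]]] eXZ _] := linkP le; subst e; exists u, v; split.
  - exists (X `|` Z) => //; apply/seteqP; split=> z.
      by move=> Xz; split; [left|exact: XI].
    by case=> -[//|/ZI].
  - by move=> Iu; have [|/XI|] := eXZ u; first by left.
  - by move=> Iv; have [|/XI|] := eXZ v; first by right.
have [[Z bZ ZW]|[Z bZ ZW]] := Br_dual neg A W.
  have [u [v [uv uZ vZ]]] := @edge false _ bZ.
  have ZnW z : Z z -> ~ W z by move=> Zz Wz; have : set0 z by rewrite -ZW.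
  exact: noG uv (fun Iu => ZnW _ (uZ Iu)) (fun Iv => ZnW _ (vZ Iv)).
have [u [v [uv uZ vZ]]] := @edge true _ bZ.
exact: noH uv (fun Iu => ZW _ (uZ Iu)) (fun Iv => ZW _ (vZ Iv)).
Qed.

Lemma complete_path_dual x s : complete_alt_path I G H X x s ->
  exists2 a, labels_set Gamma a x & labels_set Gamma (neg a) (last x s).
Proof.
move=> /[dup] cp [_ nIx nIl]; have [b [s' [y [sE w sI]]]] := complete_path cp.
subst s; rewrite last_rcons in nIl *.
have [a ax] : exists a, lab b a x.
  by case: s' w {cp sI} => [|z s'] /= [/E_dual[a ax _] _]; exists a.
by exists a; [exact: lab_out ax|exact: walk_dual w sI ax nIl].
Qed.

(** The first edge is labeled by a branch of a premiss, and removing [I] leaves its part in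
    [Gamma]. *)
Lemma complete_path_br x s : complete_alt_path I G H X x s -> Br_set Gamma X.
Proof.
move=> cp; have [b [s' [y [-> w _]]]] := complete_path cp.
have [z [Y lY ->]] : exists z, E b x z.
  by case: s' w => [|z s'] [xz _]; [exists y|exists z].
move: (full_br (full_gr b) lY); rewrite Br_setU1; last by case: (b).
move=> [Y' brY' [Z /Br_names + <-]]; rewrite names_form => ZI.
suff -> : (Y' `|` Z) `\` I = Y' by [].
apply/seteqP; split=> t; first by move=> [[//|/ZI]].
by move=> Y't; split; [left|apply: (apartP apA); case: brY' => + _; apply].
Qed.

End Cut.

Lemma full_Cut Gamma A G H :
  apart Gamma A -> apart Gamma (fneg neg A) ->
  sequent (Gamma ,, A) -> sequent (Gamma ,, fneg neg A) ->
  full_on (Gamma ,, A) G -> full_on (Gamma ,, fneg neg A) H ->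
  full_on Gamma (gcomp (names A) G H).
Proof.
move=> apA apC sA sC fG fH.
have VE : (verts G `|` verts H) `\` names A = names_set Gamma.
  rewrite (full_verts fG) (full_verts fH) !names_setU1 names_fneg setUid.
  by rewrite setDUl setDv setU0; apply/setDidPl.
split=> //=.
- move=> e X [x [y [_ _ _ _ [s cp _]]]].
  exact: (complete_path_br apA apC fG fH cp).
- move=> u v X [x [y [_ uv _ _ [s cp lx]]]].
  have [a ax] := complete_path_dual apA sA sC fG fH cp.
  rewrite lx => ay; case: (set2_inj uv) => -[-> ->]; first by exists a.
  by exists (neg a); rewrite ?negK.
- move=> X brX.
  have [x [s [cp nx]]] := complete_path_ex apA apC sA sC fG fH brX.
  have [XG _] := brX.
  exists [set x; last x s], x, (last x s); rewrite VE; split=> //.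
  + exact/nesym.
  + apply: subset_trans XG; case: cp => -[s1 _ _ _ p] nIx nIl.
    by case: p => p; exact: alt_path_from_ends p.
  + by exists s.
Qed.

(** * Fullness of the graphs of derivations *)

Lemma deriv_sequent Gamma : deriv neg Gamma -> sequent Gamma.
Proof. by case. Qed.

Lemma full_interp Gamma (P : deriv neg Gamma) : full_on Gamma (interp P).
Proof.
elim: P => {}Gamma.
- move=> A B AB apA apB sq /=; apply: full_wk => //; apply: full_idg => //.
  by case/apartUr: apB => _; rewrite names_fneg.
- move=> A apA apC sq Q fQ R fR /=.
  by apply: full_Cut fQ fR => //; [exact: deriv_sequent Q|exact: deriv_sequent R].
- by move=> sq Q fQ R fR; exact: full_Sup.
- by move=> A B apA apB apAB sq Q fQ /=; rewrite full_Or.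
- by move=> A B apA apB apAB sq Q fQ R fR; exact: full_And.
Qed.

(** * Sequentialization *)

Fact restrict_linkP BB V (BV : forall X, BB X -> X `<=` V) G e X :
  link G e X /\ BB X ->
  [/\ exists x y, x <> y /\ e = [set x; y], e `<=` X & X `<=` V].
Proof. by move=> [/linkP[pe eX _] /BV]. Qed.

Definition restrict BB V (BV : forall X, BB X -> X `<=` V) G : blgraph N :=
  BlGraph (restrict_linkP BV (G := G)).

(** Typing is compared only on [V'], because an edge lies inside its label. *)
Lemma full_restrict L L' BB BB' V V' (BV : forall X, BB' X -> X `<=` V') G :
  BB' `<=` BB -> (forall a x, L a x -> V' x -> L' a x) ->
  full L BB V G -> full L' BB' V' (restrict BV G).
Proof.
move=> sBB sL [vG bG dG eG]; split=> //=.
- by move=> e X [].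
- move=> u v X [l /BV XV']; have [a au av] := dG _ _ _ l.
  have [_ uvX _] := linkP l.
  by exists a; apply: sL => //; apply/XV'/uvX; [left|right].
- by move=> X bX; have [e le] := eG _ (sBB _ bX); exists e.
Qed.

(** Every label chooses a conjunct, so the two restrictions together recover [G]; disjointness keeps
    edges over a branch through one conjunct away from the names of the other. *)
Lemma full_And_split Gamma A B G :
  apart Gamma A -> apart Gamma B -> apart Gamma (And A B) ->
  names A `&` names B = set0 ->
  full_on (Gamma ,, And A B) G ->
  exists G1 G2, [/\ full_on (Gamma ,, A) G1, full_on (Gamma ,, B) G2 &
    G = gunion G1 G2].
Proof.
move=> apA apB apAB AB fG.
have BV C X : Br_set (Gamma ,, C) X -> X `<=` names_set (Gamma ,, C) by case.
exists (restrict (BV A) G), (restrict (BV B) G); split.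
- apply: full_restrict fG => [X|a x].
    by rewrite Br_set_And //; left.
  rewrite !labels_setU1 names_setU1 /= => -[Ga|[Aa|Ba]]; [by left|by right|].
  have Bx := labels_names Ba.
  case=> [Gx|Ax]; first by case: (apartP apB Gx).
  by have : set0 x by rewrite -AB.
- apply: full_restrict fG => [X|a x].
    by rewrite Br_set_And //; right.
  rewrite !labels_setU1 names_setU1 /= => -[Ga|[Aa|Ba]]; [by left| |by right].
  have Ax := labels_names Aa.
  case=> [Gx|Bx]; first by case: (apartP apA Gx).
  by have : set0 x by rewrite -AB.
- apply: blgraph_ext => [|e X] /=.
    by rewrite (full_verts fG) !names_setU1 names_And setUUr.
  split=> [l|[] [//]].
  by move: (full_br fG l); rewrite Br_set_And // => -[]; [left|right].
Qed.

Definition cut_free_graph Gamma G :=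
  exists Q : deriv neg Gamma, cut_free Q /\ interp Q = G.

Definition atomic A := if A is Atom _ _ then true else false.

(** * Atomic sequents as superpositions of axioms *)

Section Atomic.
Variable Gamma : set (formula At N).
Hypotheses (sq : sequent Gamma) (at_ : forall A, Gamma A -> atomic A).

Lemma Br_set_atomic : Br_set Gamma = [set names_set Gamma].
Proof.
apply/seteqP; split=> X /=.
  move=> [XG brX]; apply/seteqP; split=> // x [A GA].
  have := brX _ GA; have := at_ GA; case: A GA => //= a y GA _.
  by rewrite /= names_Atom => Xy; rewrite -Xy => -[].
move=> ->; split=> // A GA; have -> : names_set Gamma `&` names A = names A.
  by apply/setIidPr => x Ax; exists A.
by have := at_ GA; case: A GA => //= a y GA _; rewrite names_Atom.
Qed.

(** Over an atomic sequent the only label is the set of all names, so a full graph amounts to its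
    set of edges. *)
Definition edges_graph (es : set (set N)) G :=
  verts G = names_set Gamma /\
  forall e X, link G e X <-> es e /\ X = names_set Gamma.

Lemma edges_graph_eq es G H : edges_graph es G -> edges_graph es H -> G = H.
Proof.
by move=> [vG lG] [vH lH]; apply: blgraph_ext => [|e X]; rewrite ?vG ?lG ?lH.
Qed.

Lemma labels_set_atomic a x : labels_set Gamma a x -> Gamma (Atom a x).
Proof.
move=> [A GA Aa]; have := at_ GA.
by case: A GA Aa => //= b y GA [<- <-].
Qed.

Lemma axiom_edge a x y : labels_set Gamma a x -> labels_set Gamma (neg a) y ->
  exists Q : deriv neg Gamma,
    cut_free Q /\ edges_graph [set [set x; y]] (interp Q).
Proof.
move=> /labels_set_atomic Gx /labels_set_atomic Gy.
(* The context of the axiom is everything but its two active atoms. *)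
pose D := Gamma `\` [set Atom a x; Atom (neg a) y].
have apD (D' : set (formula At N)) A :
    D' `<=` Gamma -> Gamma A -> ~ D' A -> apart D' A.
  move=> sD GA nDA; apply/seteqP; split=> // z [[B DB Bz] Az]; apply: nDA.
  case: sq => _ [_ tr]; suff <- : B = A by [].
  by apply: tr => //; [exact: sD|exists z].
have apx : apart D (Atom a x).
  by apply: apD => //; [by move=> A []|by move=> [_]; apply; left].
have apy : apart (D ,, Atom a x) (fneg neg (Atom a y)).
  apply: apD => //=; first by move=> A [[]|->].
  move=> [[_]|[/neg_neq//]]; by apply; right.
have GE : Gamma = D ,, Atom a x ,, fneg neg (Atom a y).
  apply/seteqP; split=> A /=.
    move=> GA; have [->|Ax] := pselect (A = Atom a x); first by left; right.
    have [->|Ay] := pselect (A = Atom (neg a) y); first by right.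
    by left; left; split=> // -[].
  by move=> [[[]//|->//]|->].
have sqE := sq; rewrite GE in sqE.
pose P := @Ax At N neg D (Atom a x) (Atom a y) erefl apx apy sqE.
suff : exists Q : deriv neg (D ,, Atom a x ,, fneg neg (Atom a y)),
  cut_free Q /\ edges_graph [set [set x; y]] (interp Q) by rewrite -GE.
exists P; split=> //.
have lE e X : link (interp P) e X -> e = [set x; y] by move=> [Y [Z [[_ ->]]]].
(* Abstracting the graph as [K] lets the sequent be rewritten; fullness then supplies the vertices,
   the label and the existence of the edge. *)
have := full_interp P; move: (interp P) lE => K lE; rewrite -GE => fK.
split=> [|e X]; first exact: full_verts fK.
split=> [l|[-> ->]].
  split; first exact: lE l.
  by have := full_br fK l; rewrite Br_set_atomic.
have [|e' l] := full_ex fK (X := names_set Gamma); first by rewrite Br_set_atomic.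
by rewrite -(lE _ _ l).
Qed.

(** One axiom per listed pair, joined by [Sup]; the last pair gives the base derivation. *)
Lemma superposed_edges (l : seq (N * N)) : l != [::] ->
  (forall x y, (x, y) \in l ->
    exists2 a, labels_set Gamma a x & labels_set Gamma (neg a) y) ->
  exists Q : deriv neg Gamma, cut_free Q /\
    edges_graph [set e | exists2 p, p \in l & e = [set p.1; p.2]] (interp Q).
Proof.
elim: l => [//|[x y] l IHl] _ dual.
have [|a ax ay] := dual x y; first by rewrite mem_head.
have [Q [cQ [vQ lQ]]] := axiom_edge ax ay.
have [l0|l_neq0] := eqVneq l [::].
  exists Q; split=> //; split=> // e X; rewrite lQ l0.
  split=> -[+ ->].
    by move=> ->; split=> //; exists (x, y); rewrite ?mem_head.
  by move=> [p]; rewrite inE => /eqP-> ->.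
have [|R [cR [vR lR]]] := IHl l_neq0.
  by move=> x' y' l'; apply: dual; rewrite inE l' orbT.
exists (Sup sq Q R); split; first by rewrite /= cQ.
split=> [|e X] /=; first by rewrite vQ vR setUid.
rewrite lQ lR; split.
  move=> [[-> ->]|[[p pl ->] ->]]; split=> //.
    by exists (x, y); rewrite ?mem_head.
  by exists p => //; rewrite inE pl orbT.
move=> [[p +] -> ->]; rewrite inE => /predU1P[->|pl]; [by left|right].
by split=> //; exists p.
Qed.

Lemma cut_free_atomic (ns : seq N) G : names_set Gamma = [set` ns] ->
  full_on Gamma G -> cut_free_graph Gamma G.
Proof.
move=> nsE fG.
(* Finitely many names leave finitely many edges; each is listed in both orientations, which denote
   the same set. *)
pose l := [seq p <- [seq (x, y) | x <- ns, y <- ns] |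
  `[< link G [set p.1; p.2] (names_set Gamma) >]].
have lP x y : (x, y) \in l <-> link G [set x; y] (names_set Gamma).
  rewrite mem_filter; split=> [/andP[/asboolP]//|xy].
  apply/andP; split; first exact/asboolP.
  have [_ sxy _] := linkP xy.
  by rewrite allpairs_f //;
    [have := sxy x (or_introl erefl)|have := sxy y (or_intror erefl)]; rewrite nsE.
have GlinkP e X : link G e X <->
    (exists2 p, p \in l & e = [set p.1; p.2]) /\ X = names_set Gamma.
  split=> [exl|[[[x y] /lP + ->] ->]//].
  have := full_br fG exl; rewrite Br_set_atomic => XE; split=> //.
  have [[x [y [_ eE]]] _ _] := linkP exl.
  by exists (x, y) => //; apply/lP; rewrite -eE -XE.
have l_neq0 : l != [::].
  have [|e] := full_ex fG (X := names_set Gamma); first by rewrite Br_set_atomic.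
  by move=> /GlinkP[[p pl _] _]; apply/eqP => l0; rewrite l0 in pl.
have [Q [cQ gQ]] := superposed_edges l_neq0
  (fun x y xy => full_dual fG ((lP x y).1 xy)).
exists Q; split=> //; apply: (edges_graph_eq gQ); split; first exact: full_verts fG.
exact: GlinkP.
Qed.

End Atomic.

(** * Inversion of the rules on sequents given as lists *)

Let occs_seq (s : seq (formula At N)) := flatten (map (@occs At N) s).

Let set_consU A s : [set` A :: s] = [set` s] ,, A.
Proof.
apply/seteqP; split=> B; rewrite /= inE; first by move=> /predU1P[]; [right|left].
by move=> [->|->]; rewrite ?eqxx ?orbT.
Qed.

Let names_seq s : names_set [set` s] = [set` occs_seq s].
Proof.
elim: s => [|A s IHs]; first by rewrite !set_nil /names_set bigcup_set0.
rewrite set_consU names_setU1 IHs; apply/seteqP; split=> x.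
  by rewrite /= mem_cat; case=> ->; rewrite ?orbT.
by rewrite /= mem_cat => /orP[]; [right|left].
Qed.

Let apart_cons A s : uniq (occs_seq (A :: s)) -> apart [set` s] A.
Proof.
rewrite /= cat_uniq => /and3P[_ /hasPn sA _].
apply/seteqP; split=> // x; rewrite names_seq => -[/= sx Ax].
by move: (sA _ sx); rewrite /= (Ax : x \in occs A).
Qed.

(** Uniqueness in the concatenated list of names says at once that each formula is sharing-free and
    that distinct ones have disjoint names. *)
Let sequent_seq s : uniq (occs_seq s) -> sequent [set` s].
Proof.
move=> us; split; first exact: finite_seq.
elim: s us => [|A s IHs] us.
  by split=> [A|A B]; rewrite set_nil.
have apA := apart_cons us.
have [sfs trs] : sharing_free_set [set` s].
  by apply: IHs; move: us; rewrite /= cat_uniq => /and3P[].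
rewrite set_consU; split=> [B [/sfs //|->]|].
  by move: us; rewrite /= cat_uniq => /and3P[].
move=> B C [sB|->] [sC|->] // [x [Bx Cx]]; first by apply: trs => //; exists x.
  by case: (apartP apA _ Cx); exists B.
by case: (apartP apA _ Bx); exists C.
Qed.

Let sequent_uniq s : uniq s -> sharing_free_set [set` s] -> uniq (occs_seq s).
Proof.
elim: s => [//|A s IHs] /= /andP[nsA us] [sf tr].
rewrite cat_uniq; apply/and3P; split.
- by apply: sf; rewrite /= mem_head.
- apply/hasPn => x xs; apply/negP => Ax.
  have [B sB Bx] : names_set [set` s] x by rewrite names_seq.
  have AB : A = B.
    by apply: tr; rewrite /= ?inE ?eqxx ?(sB : B \in s) ?orbT //; exists x.
  by rewrite AB (sB : B \in s) in nsA.
- apply: IHs us _; split=> [B sB|B C sB sC].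
    by apply: sf; rewrite /= inE (sB : B \in s) orbT.
  by apply: tr; rewrite /= inE ?(sB : B \in s) ?(sC : C \in s) orbT.
Qed.

Fixpoint weight A : nat :=
  match A with
  | Atom _ _ => 1
  | Or B C | And B C => (weight B + weight C).+1
  end.

(** [s] holds the formulas still to be decomposed, [t] the atoms set aside. The weight of [s] drops
    when a connective is removed and when an atom moves to [t]. *)
Lemma cut_free_seq n s t G : sumn (map weight s) <= n ->
  all atomic t -> uniq (occs_seq (s ++ t)) -> full_on [set` s ++ t] G ->
  cut_free_graph [set` s ++ t] G.
Proof.
elim: n s t G => [|n IHn] [|A s] t G //=.
1,3: move=> _ /allP at_ us fG;
  exact: (cut_free_atomic (sequent_seq us) at_ (names_seq t) fG).
(* Weights are positive, so the bound 0 excludes a nonempty [s]. *)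
- by case: A.
case: A => [a x|A B|A B] /= wn at_ us.
- have perm_t : perm_eq (Atom a x :: s ++ t) (s ++ Atom a x :: t).
    exact: permEl (perm_catCA [:: Atom a x] s t).
  have -> : [set` Atom a x :: s ++ t] = [set` s ++ Atom a x :: t].
    by apply/seteqP; split=> A /=; rewrite (perm_mem perm_t).
  apply: IHn => //=.
  by rewrite -(perm_uniq (perm_flatten (perm_map _ perm_t))).
- have us' : uniq (occs_seq (B :: A :: s ++ t)).
    by move: us; rewrite /occs_seq /= -catA (perm_uniq (permEl (perm_catCA _ _ _))).
  have usA : uniq (occs_seq (A :: s ++ t)).
    by move: us'; rewrite /= cat_uniq => /and3P[].
  have apA := apart_cons usA.
  have apB : apart ([set` s ++ t] ,, A) B by rewrite -set_consU; exact: apart_cons.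
  have apAB : apart [set` s ++ t] (Or A B) by exact: apart_cons.
  rewrite set_consU full_Or // -!set_consU => fG.
  (* The premiss keeps [G] itself, since [OrI] does not change the graph. *)
  have [|Q [cQ QG]] := IHn [:: B, A & s] t G _ at_ us' fG.
    by rewrite /= addnA [(weight B + _)%N]addnC.
  have sq : sequent ([set` s ++ t] ,, Or A B).
    by rewrite -set_consU; exact: sequent_seq.
  rewrite set_consU.
  (* The derivation is generalized with its properties so that its index can be rewritten to the
     premiss of the rule. *)
  move: Q cQ QG; rewrite /= !set_consU => Q cQ QG.
  by exists (OrI apA apB apAB sq Q).
- rewrite addSn ltnS in wn.
  have [usA usB] : uniq (occs_seq (A :: s ++ t)) /\ uniq (occs_seq (B :: s ++ t)).
    move: us; rewrite /occs_seq /= -catA !cat_uniq has_cat negb_or -!andbA.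
    by move=> /and5P[-> _ -> -> /andP[-> ->]].
  have apA := apart_cons usA; have apB := apart_cons usB.
  have apAB : apart [set` s ++ t] (And A B) by exact: apart_cons.
  have sq : sequent ([set` s ++ t] ,, And A B).
    by rewrite -set_consU; exact: sequent_seq.
  rewrite set_consU => /full_And_split[] //.
    apply/seteqP; split=> // x [Ax Bx]; move: us.
    rewrite /= !cat_uniq => /and3P[/and3P[_ /hasPn /(_ _ Bx)]].
    by rewrite /= (Ax : x \in occs A).
  move=> G1 [G2 []]; rewrite -!set_consU => f1 f2 ->.
  have [|Q [cQ QG]] := IHn (A :: s) t G1 _ at_ usA f1.
    by rewrite (leq_trans _ wn) //= leq_add2r leq_addr.
  have [|R [cR RG]] := IHn (B :: s) t G2 _ at_ usB f2.
    by rewrite (leq_trans _ wn) //= leq_add2r leq_addl.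
  move: Q R cQ cR QG RG; rewrite /= !set_consU => Q R cQ cR <- <-.
  by exists (AndI apA apB apAB sq Q R); rewrite /= cQ cR.
Qed.

Lemma full_cut_free Gamma G :
  sequent Gamma -> full_on Gamma G -> cut_free_graph Gamma G.
Proof.
move=> [/finite_seqP[s ->] sf].
(* Repetitions are removed because a repeated formula would repeat its names. *)
have sE : [set` s] = [set` undup s].
  by apply/seteqP; split=> A /=; rewrite mem_undup.
rewrite sE -(cats0 (undup s)) => fG; apply: cut_free_seq (leqnn _) _ _ fG => //.
by rewrite cats0; apply: sequent_uniq; [exact: undup_uniq|rewrite -sE].
Qed.

End Full.

Unset Implicit Arguments.

Theorem theorem3 (At : Type) (neg : At -> At) (N : countType)
    (negK : involutive neg) (neg_neq : forall a : At, neg a <> a)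
    (N_infinite : infinite_set [set: N])
    (Gamma : set (formula At N)) (P : deriv neg Gamma) :
  exists Q : deriv neg Gamma, cut_free Q /\ interp P = interp Q.
Proof.
have [Q [cQ QP]] := full_cut_free negK neg_neq (deriv_sequent P)
  (full_interp negK neg_neq P).
by exists Q.
Qed.
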